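(* Let $P=(P_{i,j})_{0\le i,j\le N}$ be an irreducible stochastic matrix partitioned into $r\times r$ blocks, with $RG$-factorization $I-P=(I-R)(I-\Phi)(I-G)$. Let $\pi=[\pi_0,\pi_1,\dots,\pi_N]$ be the stationary row vector (to be normalized at the end), with blocks $\pi_j\in\mathbb R^{1\times r}$, and define $$y=\pi(I-R),\qquad z=y(I-\Phi).$$ Then the stationary equation $\pi(I-P)=0$ is equivalent to the triangular left-null equation $z(I-G)=0$. Moreover: (1) (Forward elimination) Since $I-G$ is unit lower block-triangular, the equation $z(I-G)=0$ forces $$z_j=0\quad\text{for all }j\ge1,\qquad\text{and } z_0\text{ is free.}$$ Because $z_j=y_j(I-\Phi_j)$ and $I-\Phi_j$ is invertible for $j\ge1$, $$y_j=0\quad\text{for all }j\ge1,\qquad\text{while } z_0=y_0(I-\Phi_0)\in\ker_{\mathrm{left}}(I-\Phi_0).$$ Thus $y=[y_0,0,\dots,0]$ with $y_0$ a (nonzero) multiple of the stationary row vector of $\Phi_0$. (2) (Back substitution) Since $I-R$ is unit upper block-triangular, $y=\pi(I-R)$ reads, blockwise, $y_0=\pi_0$ and $y_j=\pi_j-\sum_{i<j}\pi_iR_{i,j}$ for $j=1,\dots,N$. Since $y_j=0$ for all $j\ge1$, this gives the recursion $$\pi_j=\sum_{i<j}\pi_iR_{i,j}\qquad(j=1,\dots,N),$$ with the level-$0$ seed $\pi_0=y_0$ chosen as the stationary row vector of $\Phi_0$ (up to a common positive scalar). Finally, $\pi$ is normalized by dividing it by the sum of all entries of $\pi_0,\dot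s,\pi_N$.
   Context: States are $(i,\alpha)$ with level $i\in\{0,\dots,N\}$ and phase $\alpha\in\{1,\dots,r\}$; $L_i=\{(i,\alpha):1\le\alpha\le r\}$, $L_{\le n}=\bigcup_{i=0}^nL_i$; $(X_n)$ is the Markov chain with transition matrix $P$. For a square matrix $A$, $\ker_{\mathrm{left}}(A)$ is the set of row vectors $v$ with $vA=0$. The blocks of $y$ and $z$ are written $y_j,z_j$ ($0\le j\le N$). $R$ is the strictly upper block-triangular matrix with blocks $R_{i,j}$ ($0\le i<j\le N$), where the $(\alpha,\beta)$ entry of the $r\times r$ matrix $R_{i,j}$ is the expected number of visits to $(j,\beta)$ before hitting (at a time $\ge1$) any state in $L_{\le j-1}$, given $X_0=(i,\alpha)$. $G$ is the strictly lower block-triangular matrix with blocks $G_{i,j}$ ($0\le j<i\le N$), where the $(\alpha,\beta)$ entry of the $r\times r$ matrix $G_{i,j}$ is the probability of hitting $(j,\beta)$ when the process enters $L_{\le i-1}$ for the first time, given $X_0=(i,\alpha)$. $\Phi=\mathrm{diag}(\Phi_0,\dots,\Phi_N)$ with $\Phi_k=P^{(k)}_{k,k}$, where $P^{(k)}$ is the transition matrix of the chain censored to $L_{\le k}$ (observed only at its successive visits to $L_{\le k}$) and $P^{(k)}_{k,k}$ is its block of transitions from level $k$ to level $k$.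
   Formalization: ''z_0 is free'' is read as: the block equations of z(I-G)=0 at levels j≥1 put no constraint on z_0; literally it fails, since I-G is invertible and z(I-G)=0 forces z_0=0 too. *)

(* Defs.v *)
From HB Require Import structures.
From mathcomp Require Import all_boot all_order all_algebra.
From mathcomp Require Import all_classical all_reals all_analysis.

Set Implicit Arguments.
Unset Strict Implicit.
Unset Printing Implicit Defensive.

Import Order.TTheory GRing.Theory Num.Theory.

Local Open Scope classical_set_scope.
Local Open Scope ring_scope.

Definition stochastic (K : realType) (n : nat) (A : 'M[K]_n) : Prop :=
  (forall a b, 0 <= A a b) /\ (forall a, \sum_b A a b = 1).

Definition irreducible (K : realType) (n : nat) (A : 'M[K]_n) : Prop :=
  forall a b, exists m : nat, 0 < (A ^+ m) a b.

Definition stationary (K : realType) (n : nat) (A : 'M[K]_n) (v : 'rV[K]_n) :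
    Prop :=
  [/\ v *m A = v, forall a, 0 <= v 0 a & \sum_a v 0 a = 1].

Definition unit_lower_block (K : realType) (N r : nat)
    (A : 'M[K]_(\sum_(i < N.+1) r)) : Prop :=
  (forall i, submxblock A i i = 1%:M) /\
  (forall i j : 'I_N.+1, (i < j)%N -> submxblock A i j = 0).

Definition unit_upper_block (K : realType) (N r : nat)
    (A : 'M[K]_(\sum_(i < N.+1) r)) : Prop :=
  (forall i, submxblock A i i = 1%:M) /\
  (forall i j : 'I_N.+1, (j < i)%N -> submxblock A i j = 0).

Definition state (N r : nat) : Type := ('I_N.+1 * 'I_r)%type.

Definition level_le (N r n : nat) : pred (state N r) :=
  fun s => (s.1 <= n)%N.

(* [Pr s] is the law of the chain started at [s].  The last clause is the
   Markov property with the conditioning multiplied out, so that histories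
   [h 0, ..., h n] of probability zero need no separate treatment. *)
Definition markov_chain (K : realType) (N r : nat)
    (P : 'I_N.+1 -> 'I_N.+1 -> 'M[K]_r)
    (d : measure_display) (Omega : measurableType d)
    (Pr : state N r -> probability Omega K)
    (X : nat -> Omega -> state N r) : Prop :=
  [/\ forall n s, measurable [set w | X n w = s],
      forall s, Pr s [set w | X 0%N w = s] = 1%E &
      forall s (n : nat) (h : nat -> state N r) (t : state N r),
        Pr s [set w | (forall m, (m <= n)%N -> X m w = h m) /\ X n.+1 w = t]
        = (Pr s [set w | forall m, (m <= n)%N -> X m w = h m]
           * (P (h n).1 t.1 (h n).2 t.2)%:E)%E].

Section RG.
Context (K : realType) (N r : nat) (d : measure_display).
Context (Omega : measurableType d) (Pr : state N r -> probability Omega K).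
Context (X : nat -> Omega -> state N r).
Implicit Types (A : pred (state N r)) (s t : state N r) (i j k : 'I_N.+1).

(* Visit to [t] at time [n], strictly before the first time [>= 1] in [A]. *)
Definition visit_before A t (n : nat) : set Omega :=
  [set w | X n w = t /\ forall m, (1 <= m <= n)%N -> ~~ A (X m w)].

(* The number of visits may be infinite, hence the extended-real integral; its
   value is finite for irreducible chains when [A] is nonempty. *)
Definition expected_visits_before A s t : K :=
  fine (\int[Pr s]_w (\sum_(n <oo) (\1_(visit_before A t n) w)%:E))%E.

Definition first_entry_at A t : set Omega :=
  [set w | exists n, [/\ X n w = t, A (X n w) &
                         forall m, (m < n)%N -> ~~ A (X m w)]].

(* The event that the chain censored to [A] is in state [t] at censored time
   [m], i.e. that visit number [m] to [A] (counted from 0) is to [t]. *)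
Definition censored_at A (m : nat) t : set Omega :=
  [set w | exists n, [/\ X n w = t, A (X n w) &
                         (\sum_(l < n) A (X l w))%N = m]].

(* For [s] in [A], the chain started at [s] has its visit number 0 to [A] at
   time 0, so this is the one-step transition probability. *)
Definition censored_trans A s t : K := fine (Pr s (censored_at A 1 t)).

Definition R_block i j : 'M[K]_r :=
  \matrix_(a, b) expected_visits_before (@level_le N r j.-1) (i, a) (j, b).

Definition G_block i j : 'M[K]_r :=
  \matrix_(a, b) fine (Pr (i, a) (first_entry_at (@level_le N r i.-1) (j, b))).

Definition Phi_block k : 'M[K]_r :=
  \matrix_(a, b) censored_trans (@level_le N r k) (k, a) (k, b).

Definition R_mx : 'M[K]_(\sum_(i < N.+1) r) :=
  \mxblock_(i, j) (if (i < j)%N then R_block i j else 0).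

Definition G_mx : 'M[K]_(\sum_(i < N.+1) r) :=
  \mxblock_(i, j) (if (j < i)%N then G_block i j else 0).

Definition Phi_mx : 'M[K]_(\sum_(i < N.+1) r) := \mxdiag_k Phi_block k.

End RG.

(* Main.v *)
Require Import Defs.
From HB Require Import structures.
From mathcomp Require Import all_boot all_order all_algebra.
From mathcomp Require Import all_classical all_reals all_analysis.
From mathcomp Require Import zify.

Set Implicit Arguments.
Unset Strict Implicit.
Unset Printing Implicit Defensive.

Import Order.TTheory GRing.Theory Num.Theory.

Local Open Scope ring_scope.

(** Write [I - P = (I - R) (I - Phi) (I - G)].  The outer factors are unit
    block-triangular, hence invertible ([unit_lower_block_unitmx] and
    [unit_upper_block_unitmx]), so [p (I - P) = 0] holds exactly when
    [y = p (I - R)] is a left null vector of the block-diagonal [I - Phi], that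
    is, when [y_j (I - Phi_j) = 0] for every level [j].

    The left kernel of [I - P] is a line: it has the dimension of the right
    kernel, which the maximum principle for the irreducible matrix [P] reduces
    to the constant vectors ([irreducible_rank_kermx]).  Ranks are additive over
    diagonal blocks, so the kernels of the [I - Phi_j] have total dimension at
    most one ([rank_kermx_Phi]).  Multiplying the factorization by the column
    of ones gives [Phi_0 1 = 1] ([Phi0_stochastic]), so [I - Phi_0] is singular
    and takes this single dimension, and all the other [I - Phi_j] are
    invertible ([Phi_unit]).

    Everything else follows.  A null vector has [y_j = 0] for [j >= 1], and
    [y_0] is a multiple of the stationary vector of [Phi_0], which exists because
    [Phi_0] is stochastic ([stochastic_stationary]).  Reading [y = p (I - R)]
    block by block turns [y_j = 0] into the recursion.  Conversely, the
    recursion started at a positive multiple of that stationary vector yields a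
    left null vector of [I - P], nonnegative since [R] is, and normalizing it
    gives the only stationary vector of [P]. *)

(** * Left null vectors of stochastic matrices *)

Lemma kermx_line (F : fieldType) (n : nat) (A : 'M[F]_n) (u v : 'rV[F]_n) :
  (\rank (kermx A) <= 1)%N -> v != 0 -> v *m A = 0 -> u *m A = 0 ->
  exists c : F, u = c *: v.
Proof.
move=> rk v0 /sub_kermxP vA /sub_kermxP uA; apply/sub_rVP.
apply: submx_trans uA _.
by rewrite -(geq_leqif (mxrank_leqif_sup vA)) rank_rV v0.
Qed.

Section Stochastic.
Context (K : realType) (n : nat) (A : 'M[K]_n).
Hypothesis stochA : stochastic A.

Lemma stochastic_mul_const1 : (1%:M - A) *m (const_mx 1 : 'cV_n) = 0.
Proof.
apply/colP => a; rewrite mulmxBl mul1mx !mxE.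
under eq_bigr do rewrite mxE mulr1.
by rewrite stochA.2 subrr.
Qed.

Lemma stochastic_sum_mulmx (v : 'rV[K]_n) :
  \sum_b (v *m A) 0 b = \sum_a v 0 a.
Proof.
under eq_bigr do rewrite mxE.
rewrite exchange_big /=; apply: eq_bigr => a _.
by rewrite -mulr_sumr stochA.2 mulr1.
Qed.

Lemma stochastic_expr_ge0 (m : nat) (a b : 'I_n) : 0 <= (A ^+ m) a b.
Proof.
elim: m a b => [|m IH] a b; first by rewrite expr0 mxE ler0n.
by rewrite exprS mxE sumr_ge0// => c _; rewrite mulr_ge0 ?stochA.1.
Qed.

(** The maximum principle.  If [a] maximises the fixed vector [u], the
    nonnegative vector [u a - u] is fixed by every power of [A] and vanishes at
    [a]; so every term of its [a]-th entry vanishes, and irreducibility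
    provides for each [b] a power with a positive weight at [b]. *)
Lemma irreducible_fixed_const (u : 'cV[K]_n) :
  irreducible A -> (1%:M - A) *m u = 0 -> forall a b, u a 0 = u b 0.
Proof.
move=> irrA Au.
suff max_const a : (forall b, u b 0 <= u a 0) -> forall b, u b 0 = u a 0.
  move=> a b; have [c _ cmax] := arg_maxP (fun i => u i 0) (erefl (xpredT a)).
  by rewrite !(max_const c) // => i; apply: cmax.
move=> amax b.
pose w : 'cV[K]_n := const_mx (u a 0) - u.
have w_ge0 c : 0 <= w c 0 by rewrite !mxE subr_ge0.
have Aw : A *m w = w.
  apply/eqP; rewrite eq_sym -subr_eq0 -{1}[w]mul1mx -mulmxBl; apply/eqP.
  rewrite mulmxBr Au subr0 -[u a 0]mulr1 -[_ * 1]/(u a 0 *: 1) -scalemx_const.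
  by rewrite -scalemxAr stochastic_mul_const1 scaler0.
have Amw m : (A ^+ m) *m w = w.
  by elim: m => [|m IH]; [rewrite expr0 mul1mx | rewrite exprS -mulmxA IH].
have [m Am_gt0] := irrA a b.
have /eqP := congr1 (fun v : 'cV_n => v a 0) (Amw m).
rewrite [in X in _ == X -> _]/w !mxE subrr psumr_eq0; last first.
  by move=> c _; rewrite mulr_ge0 ?stochastic_expr_ge0.
move=> /allP /(_ b (mem_index_enum b)) /=.
by rewrite mulf_eq0 gt_eqF //= !mxE subr_eq0 => /eqP.
Qed.

(** The left kernel has the dimension of the right kernel, which consists of
    constant vectors. *)
Lemma irreducible_rank_kermx : irreducible A ->
  (\rank (kermx (1%:M - A)) <= 1)%N.
Proof.
move=> irrA; rewrite mxrank_ker -mxrank_tr -mxrank_ker.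
suff sub1 : (kermx (1%:M - A)^T <= (const_mx 1 : 'rV[K]_n))%MS.
  exact: leq_trans (mxrankS sub1) (rank_leq_row _).
apply/row_subP => i; set v := row i _.
have /(congr1 trmx) : v *m (1%:M - A)^T = 0.
  by rewrite /v -row_mul mulmx_ker row0.
rewrite trmx_mul trmxK trmx0 => /(irreducible_fixed_const irrA) vconst.
apply/sub_rVP; exists (v 0 i); apply/rowP => j.
by rewrite [in RHS]mxE [const_mx _ _ _]mxE mulr1; have := vconst j i; rewrite !mxE.
Qed.

(** [1 - A] kills the column of ones, hence is singular and kills some row
    [v].  By the triangle inequality [|v| <= |v| A] entrywise, and both sides
    have the same total because [A] has unit row sums; so [|v|] is invariant. *)
Lemma stochastic_stationary : (0 < n)%N ->
  exists phi : 'rV[K]_n, stationary A phi.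
Proof.
move=> n_gt0.
have /rowV0Pn[v /sub_kermxP] : kermx (1%:M - A) != 0.
  rewrite kermx_eq0 row_free_unit; apply/negP => uA.
  have := mulKmx uA (const_mx 1 : 'cV_n).
  rewrite stochastic_mul_const1 mulmx0 => /colP /(_ (Ordinal n_gt0)).
  by rewrite !mxE => /eqP; rewrite eq_sym oner_eq0.
rewrite mulmxBr mulmx1 => /eqP; rewrite subr_eq0 => /eqP vA v0.
pose w := map_mx Num.norm v.
have w_ge0 a : 0 <= w 0 a by rewrite mxE.
have w_le b : w 0 b <= (w *m A) 0 b.
  rewrite [w 0 b]mxE vA !mxE (le_trans (ler_norm_sum _ _ _))// ler_sum// => a _.
  by rewrite normrM [w 0 a]mxE (ger0_norm (stochA.1 a b)).
have wA : w *m A = w.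
  apply/rowP => b; apply/eqP; rewrite -subr_eq0.
  have : \sum_b ((w *m A) 0 b - w 0 b) == 0.
    by rewrite sumrB stochastic_sum_mulmx subrr.
  rewrite psumr_eq0 => [/allP/(_ b (mem_index_enum b))//|c _].
  by rewrite subr_ge0.
have s_neq0 : \sum_a w 0 a != 0.
  apply: contra v0; rewrite psumr_eq0// => /allP w0.
  apply/eqP/rowP => a; have := w0 a (mem_index_enum a).
  by rewrite mxE normr_eq0 mxE => /eqP.
exists ((\sum_a w 0 a)^-1 *: w); split.
- by rewrite -scalemxAl wA.
- by move=> a; rewrite mxE mulr_ge0 ?invr_ge0 ?sumr_ge0.
- under eq_bigr do rewrite mxE.
  by rewrite -mulr_sumr mulVf.
Qed.

End Stochastic.

Lemma stationary_kermx (K : realType) (n : nat) (A : 'M[K]_n) (v : 'rV[K]_n) :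
  stationary A v -> v *m (1%:M - A) = 0 /\ v != 0.
Proof.
case=> vA _ v1; split; first by rewrite mulmxBr mulmx1 vA subrr.
apply/eqP => v0; move: v1; rewrite v0; under eq_bigr do rewrite mxE.
by move/eqP; rewrite sumr_const mul0rn eq_sym oner_eq0.
Qed.

(** * Block-triangular and block-diagonal matrices *)

Section Blocks.
Context (K : realType) (N r : nat).
Notation sz := (\sum_(i < N.+1) r)%N.

Lemma submxrow_mul (m : nat) (v : 'M[K]_(m, sz)) (A : 'M[K]_sz) (j : 'I_N.+1) :
  submxrow (v *m A) j = \sum_i submxrow v i *m submxblock A i j.
Proof.
by rewrite -{1}[v]submxrowK -{1}[A]submxblockK mul_mxrow_mxblock mxrowK.
Qed.

Lemma mxrow_eq0 (m : nat) (v : 'M[K]_(m, sz)) :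
  (forall j, submxrow v j = 0) -> v = 0.
Proof. by move=> v0; apply/mxrowP => j; rewrite v0 submxrow0. Qed.

Lemma submxblock1 (i j : 'I_N.+1) :
  submxblock (1%:M : 'M[K]_sz) i j = if i == j then 1%:M else 0.
Proof.
rewrite -mxdiagZ /mxdiag mxblockK; case: eqP => [ij|//].
by case: _ / ij; rewrite conform_mx_id.
Qed.

(** Back substitution from the last level: once the blocks above [j] of a left
    null vector vanish, column [j] of the equation reads [v_j = 0]. *)
Lemma unit_lower_block_unitmx (A : 'M[K]_sz) :
  unit_lower_block A -> A \in unitmx.
Proof.
move=> [A1 A0]; rewrite -row_free_unit -kermx_eq0; apply/rowV0P => v.
move=> /sub_kermxP vA; apply: mxrow_eq0.
suff H k (j : 'I_N.+1) : (N - j <= k)%N -> submxrow v j = 0 by move=> j; exact: H.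
elim/ltn_ind: k j => k IH j jk.
have := congr1 (fun w => submxrow w j) vA.
rewrite submxrow_mul submxrow0 (bigD1 j)//= A1 mulmx1 big1 ?addr0// => i ij.
have [lt_ij|le_ji] := ltnP i j; first by rewrite A0 ?mulmx0.
have lt_ji : (j < i)%N by rewrite ltn_neqAle eq_sym ij.
rewrite (IH (N - i)%N _ i) ?mul0mx// (leq_trans _ jk)// ltn_sub2l//.
by rewrite (leq_trans lt_ji)// -ltnS.
Qed.

Lemma unit_upper_block_unitmx (A : 'M[K]_sz) :
  unit_upper_block A -> A \in unitmx.
Proof.
move=> [A1 A0]; rewrite -unitmx_tr; apply: unit_lower_block_unitmx; split.
  by move=> i; rewrite -tr_submxblock A1 trmx1.
by move=> i j ij; rewrite -tr_submxblock A0 ?trmx0.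
Qed.

Lemma submxrow_ge0 (p : 'rV[K]_sz) :
  (forall j b, 0 <= submxrow p j 0 b) -> forall a, 0 <= p 0 a.
Proof. by move=> p_ge0 a; rewrite -[p]submxrowK mxE. Qed.

End Blocks.

Lemma rank_kermx_mxdiag (F : fieldType) (m r : nat) (B : 'I_m -> 'M[F]_r) :
  \rank (kermx (\mxdiag_i B i)) = (\sum_i \rank (kermx (B i)))%N.
Proof.
rewrite mxrank_ker rank_mxdiag -sumnB => [|i _]; last exact: rank_leq_row.
by apply: eq_bigr => i _; rewrite mxrank_ker.
Qed.

(** * Consequences of the factorization for the left null vectors *)

Section Factorization.
Context (K : realType) (N r : nat).
Notation sz := (\sum_(i < N.+1) r)%N.
Context (P R G : 'M[K]_sz) (Phi : 'I_N.+1 -> 'M[K]_r).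
Hypothesis r_gt0 : (0 < r)%N.
Hypothesis stochP : stochastic P.
Hypothesis irrP : irreducible P.
Hypothesis upR : unit_upper_block (1%:M - R).
Hypothesis loG : unit_lower_block (1%:M - G).
Hypothesis Phi0_ge0 : forall a b, 0 <= Phi ord0 a b.
Hypothesis factP :
  1%:M - P = (1%:M - R) *m (1%:M - \mxdiag_k Phi k) *m (1%:M - G).

Let uR : 1%:M - R \in unitmx := unit_upper_block_unitmx upR.
Let uG : 1%:M - G \in unitmx := unit_lower_block_unitmx loG.

Lemma one_sub_mxdiag : 1%:M - \mxdiag_k Phi k = \mxdiag_k (1%:M - Phi k).
Proof. by rewrite -(mxdiagZ 1) mxdiagB. Qed.

Lemma submxrow_mul_one_sub_mxdiag (v : 'rV[K]_sz) (j : 'I_N.+1) :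
  submxrow (v *m (1%:M - \mxdiag_k Phi k)) j = submxrow v j *m (1%:M - Phi j).
Proof.
by rewrite one_sub_mxdiag -{1}[v]submxrowK mul_mxrow_mxdiag mxrowK.
Qed.

Lemma left_null_factorization (p : 'rV[K]_sz) :
  p *m (1%:M - P) = 0 <->
  p *m (1%:M - R) *m (1%:M - \mxdiag_k Phi k) = 0.
Proof.
rewrite factP !mulmxA; split=> [pP|->]; last by rewrite mul0mx.
by rewrite -[LHS](mulmxK uG) pP mul0mx.
Qed.

Lemma rank_kermx_Phi :
  (\sum_k \rank (kermx (1%:M - Phi k)%R) <= 1)%N.
Proof.
rewrite -rank_kermx_mxdiag -one_sub_mxdiag mxrank_ker.
have -> : \rank (1%:M - \mxdiag_k Phi k) = \rank (1%:M - P).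
  rewrite factP mxrankMfree ?row_free_unit// eqmxMfull//.
  by rewrite row_full_unit.
by rewrite -mxrank_ker; exact: irreducible_rank_kermx.
Qed.

(** Applied to the column of ones, the factorization gives
    [(1 - Phi) ((1 - G) 1) = 0]; as [G] is strictly lower triangular, the
    level-0 block of [(1 - G) 1] is still the column of ones, and the level-0
    rows of the equation read [(1 - Phi_0) 1 = 0]. *)
Lemma Phi0_stochastic : stochastic (Phi ord0).
Proof.
split=> // a.
pose w : 'cV[K]_sz := (1%:M - G) *m const_mx 1.
have w0 : submxcol w ord0 = const_mx 1.
  rewrite /w -submxcol_mul -(mxcol_const (p_ := fun=> r)).
  have -> : submxcol (1%:M - G) ord0 =
      \mxrow_j (if j == ord0 then 1%:M else 0 : 'M[K]_r).
    rewrite -[LHS]submxrowK; apply: eq_mxrow => j; rewrite -submxblockEv.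
    by case: eqP => [->|/eqP j0]; [rewrite loG.1 | rewrite loG.2 ?lt0n].
  rewrite mul_mxrow_mxcol (bigD1 ord0)//= mul1mx big1 ?addr0// => j j0.
  by rewrite (negPf j0) mul0mx.
have : (1%:M - \mxdiag_k Phi k) *m w = 0.
  rewrite -[LHS](mulKmx uR) [X in _ *m X]mulmxA /w [X in _ *m X]mulmxA -factP.
  by rewrite stochastic_mul_const1 ?mulmx0.
move=> /(congr1 (fun v => submxcol v ord0)).
rewrite one_sub_mxdiag -[w]submxcolK mul_mxdiag_mxcol mxcolK w0 submxcol0.
move=> /colP /(_ a); rewrite mulmxBl mul1mx !mxE => /eqP.
rewrite subr_eq0 => /eqP ->.
by apply: eq_bigr => b _; rewrite mxE mulr1.
Qed.

Lemma rank_kermx_Phi0_gt0 : (0 < \rank (kermx (1%:M - Phi ord0)%R))%N.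
Proof.
have [phi /stationary_kermx[/sub_kermxP sub phi0]] :=
  stochastic_stationary Phi0_stochastic r_gt0.
by rewrite (leq_trans _ (mxrankS sub))// rank_rV phi0.
Qed.

Lemma rank_kermx_Phi0 : (\rank (kermx (1%:M - Phi ord0)%R) <= 1)%N.
Proof. by rewrite (leq_trans _ rank_kermx_Phi)// (bigD1 ord0)//= leq_addr. Qed.

(** The left kernel of [1 - Phi] has dimension at most one, and level 0 already
    uses it up. *)
Lemma Phi_unit (j : 'I_N.+1) : (0 < j)%N -> 1%:M - Phi j \in unitmx.
Proof.
move=> j_gt0; rewrite -row_free_unit -kermx_eq0 -mxrank_eq0 -leqn0.
have := rank_kermx_Phi; rewrite (bigD1 ord0)//= (bigD1 j)/=; last first.
  by rewrite -lt0n.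
by move=> le1; have := rank_kermx_Phi0_gt0; lia.
Qed.

(** All of the null vector [y = p (1 - R)] of [1 - Phi] sits at level 0. *)
Lemma left_null_blocks (p : 'rV[K]_sz) : p *m (1%:M - P) = 0 ->
  submxrow (p *m (1%:M - R)) ord0 *m (1%:M - Phi ord0) = 0 /\
  (forall j : 'I_N.+1, (0 < j)%N -> submxrow (p *m (1%:M - R)) j = 0).
Proof.
move=> /left_null_factorization z0; split=> [|j j_gt0].
  by rewrite -submxrow_mul_one_sub_mxdiag z0 submxrow0.
rewrite -[LHS](mulmxK (Phi_unit j_gt0)) -submxrow_mul_one_sub_mxdiag z0.
by rewrite submxrow0 mul0mx.
Qed.

Lemma stationary_Phi0_unique : exists! phi, stationary (Phi ord0) phi.
Proof.
have [phi statphi] := stochastic_stationary Phi0_stochastic r_gt0.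
exists phi; split=> // psi statpsi.
have [phiK phi0] := stationary_kermx statphi.
have [psiK _] := stationary_kermx statpsi.
have [c psiE] := kermx_line rank_kermx_Phi0 phi0 phiK psiK.
case: statphi statpsi => _ _ phi1 [_ _]; rewrite psiE.
under eq_bigr do rewrite mxE.
by rewrite -mulr_sumr phi1 mulr1 => ->; rewrite scale1r.
Qed.

(** The left kernel of [1 - Phi_0] is the line through [phi], and [c <> 0]
    because [1 - R] is invertible. *)
Lemma left_null_level0 (phi : 'rV[K]_r) (p : 'rV[K]_sz) :
  stationary (Phi ord0) phi -> p *m (1%:M - P) = 0 -> p <> 0 ->
  exists c : K, c <> 0 /\
    p *m (1%:M - R) = \mxrow_(j < N.+1) (if j == ord0 then c *: phi else 0).
Proof.
move=> /stationary_kermx[phiK phi0] /left_null_blocks[yK y0] p0.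
have [c y0E] := kermx_line rank_kermx_Phi0 phi0 phiK yK.
have yE : p *m (1%:M - R) =
    \mxrow_(j < N.+1) (if j == ord0 then c *: phi else 0).
  apply/mxrowP => j; rewrite mxrowK.
  by case: eqP => [->|/eqP j0]; [exact: y0E | rewrite y0 ?lt0n].
exists c; split=> // c0; apply: p0.
rewrite -[p](mulmxK uR) yE c0 scale0r [\mxrow_j _]mxrow_eq0 ?mul0mx// => j.
by rewrite mxrowK if_same.
Qed.

Lemma submxrow_mul_one_sub_R (p : 'rV[K]_sz) (j : 'I_N.+1) :
  submxrow (p *m (1%:M - R)) j =
  submxrow p j - \sum_(i < N.+1 | (i < j)%N) submxrow p i *m submxblock R i j.
Proof.
rewrite submxrow_mul (bigID (fun i : 'I_N.+1 => (i < j)%N)) /= addrC.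
congr (_ + _).
  rewrite (bigD1 j) ?ltnn//= upR.1 mulmx1 big1 ?addr0// => i.
  rewrite -leqNgt => /andP[ji ij].
  by rewrite upR.2 ?mulmx0// ltn_neqAle eq_sym ij.
rewrite -sumrN; apply: eq_bigr => i ij.
rewrite submxblockB submxblock1 -val_eqE /= ltn_eqF//.
by rewrite sub0r mulmxN.
Qed.

Lemma submxrow_one_sub_R0 (p : 'rV[K]_sz) :
  submxrow (p *m (1%:M - R)) ord0 = submxrow p ord0.
Proof. by rewrite submxrow_mul_one_sub_R big_pred0 ?subr0. Qed.

(** The recursion says that [p (1 - R)] is [[c phi, 0, ..., 0]], which [1 - Phi]
    kills. *)
Lemma back_substitution_null (phi : 'rV[K]_r) (c : K) (p : 'rV[K]_sz) :
  stationary (Phi ord0) phi -> submxrow p ord0 = c *: phi ->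
  (forall j : 'I_N.+1, (0 < j)%N -> submxrow p j =
     \sum_(i < N.+1 | (i < j)%N) submxrow p i *m submxblock R i j) ->
  p *m (1%:M - P) = 0.
Proof.
move=> /stationary_kermx[phiK _] p0 prec; apply/left_null_factorization.
apply: mxrow_eq0 => j; rewrite submxrow_mul_one_sub_mxdiag.
have [j0|j_gt0] := posnP j.
  have -> : j = ord0 by exact: val_inj.
  by rewrite submxrow_one_sub_R0 p0 -scalemxAl phiK scaler0.
by rewrite submxrow_mul_one_sub_R prec// subrr mul0mx.
Qed.

Lemma back_substitution_ge0 (phi : 'rV[K]_r) (c : K) (p : 'rV[K]_sz) :
  (forall (i j : 'I_N.+1) a b, 0 <= submxblock R i j a b) ->
  (forall a, 0 <= phi 0 a) -> 0 <= c -> submxrow p ord0 = c *: phi ->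
  (forall j : 'I_N.+1, (0 < j)%N -> submxrow p j =
     \sum_(i < N.+1 | (i < j)%N) submxrow p i *m submxblock R i j) ->
  forall a, 0 <= p 0 a.
Proof.
move=> R_ge0 phi_ge0 c_ge0 p0 prec; apply: submxrow_ge0 => j.
have [k] := ubnP (val j); elim: k j => // k IH j jk b.
have [j0|j_gt0] := posnP j.
  have -> : j = ord0 by exact: val_inj.
  by rewrite p0 mxE mulr_ge0.
rewrite prec// summxE sumr_ge0// => i ij.
by rewrite mxE sumr_ge0// => a _; rewrite mulr_ge0// IH// (leq_trans ij).
Qed.

(** Uniqueness: another stationary vector lies on the line through [p], and
    the unit total determines the factor. *)
Lemma normalized_null_stationary (p : 'rV[K]_sz) :
  p *m (1%:M - P) = 0 -> (forall a, 0 <= p 0 a) -> p != 0 ->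
  0 < \sum_a p 0 a /\ unique (stationary P) ((\sum_a p 0 a)^-1 *: p).
Proof.
move=> pP p_ge0 p_neq0.
have s_gt0 : 0 < \sum_a p 0 a.
  rewrite lt0r sumr_ge0// andbT psumr_eq0//; apply: contra p_neq0 => /allP p0.
  by apply/eqP/rowP => a; rewrite mxE; apply/eqP/p0; rewrite mem_index_enum.
split=> //; split; first split.
- by rewrite -scalemxAl; move/eqP: pP; rewrite mulmxBr mulmx1 subr_eq0 => /eqP <-.
- by move=> a; rewrite mxE mulr_ge0// invr_ge0 ltW.
- by under eq_bigr do rewrite mxE; rewrite -mulr_sumr mulVf ?gt_eqF.
move=> q statq; have [qP _] := stationary_kermx statq.
have rkP : (\rank (kermx (1%:M - P)) <= 1)%N by exact: irreducible_rank_kermx.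
have [c qE] := kermx_line rkP p_neq0 pP qP.
case: statq => _ _; rewrite qE; under eq_bigr do rewrite mxE.
by rewrite -mulr_sumr => cs1; rewrite -[c](mulfK (lt0r_neq0 s_gt0)) cs1 mul1r.
Qed.

End Factorization.

(** * The factors built from the chain *)

Section BlocksOfRG.
Context (K : realType) (N r : nat) (d : measure_display).
Context (Omega : measurableType d) (Pr : state N r -> probability Omega K).
Context (X : nat -> Omega -> state N r).

Lemma one_sub_G_unit_lower : unit_lower_block (1%:M - G_mx Pr X).
Proof.
split=> [i|i j ij]; rewrite submxblockB submxblock1 /G_mx mxblockK.
  by rewrite eqxx ltnn subr0.
by rewrite -val_eqE /= ltn_eqF// ltnNge ltnW// subr0.
Qed.

Lemma one_sub_R_unit_upper : unit_upper_block (1%:M - R_mx Pr X).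
Proof.
split=> [i|i j ij]; rewrite submxblockB submxblock1 /R_mx mxblockK.
  by rewrite eqxx ltnn subr0.
by rewrite -val_eqE /= gtn_eqF// ltnNge ltnW// subr0.
Qed.

Lemma R_block_ge0 (i j : 'I_N.+1) a b : 0 <= R_block Pr X i j a b.
Proof.
rewrite mxE fine_ge0// integral_ge0// => w _.
by apply: nneseries_ge0 => n _ _; rewrite lee_fin.
Qed.

Lemma Phi_block_ge0 (k : 'I_N.+1) a b : 0 <= Phi_block Pr X k a b.
Proof. by rewrite mxE fine_ge0// measure_ge0. Qed.

End BlocksOfRG.

(** * Block elimination of the stationary equation *)

Theorem mainTheorem6 (K : realType) (N r : nat) (hr : (0 < r)%N)
  (Pb : 'I_N.+1 -> 'I_N.+1 -> 'M[K]_r)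
  (P : 'M[K]_(\sum_(i < N.+1) r)) (hP : P = \mxblock_(i, j) Pb i j)
  (hstoch : stochastic P) (hirr : irreducible P)
  (d : measure_display) (Omega : measurableType d)
  (Pr : state N r -> probability Omega K)
  (X : nat -> Omega -> state N r)
  (hX : markov_chain Pb Pr X)
  (R : 'M[K]_(\sum_(i < N.+1) r)) (hR : R = R_mx Pr X)
  (Phi : 'M[K]_(\sum_(i < N.+1) r)) (hPhi : Phi = Phi_mx Pr X)
  (G : 'M[K]_(\sum_(i < N.+1) r)) (hG : G = G_mx Pr X)
  (hRG : 1%:M - P = (1%:M - R) *m (1%:M - Phi) *m (1%:M - G)) :
  (* equivalence of the two left-null equations *)
  (forall p y z : 'rV[K]_(\sum_(i < N.+1) r),
     y = p *m (1%:M - R) -> z = y *m (1%:M - Phi) ->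
     (p *m (1%:M - P) = 0 <-> z *m (1%:M - G) = 0)) /\
  (* (1) forward elimination *)
  [/\ unit_lower_block (1%:M - G),
      (forall z : 'rV[K]_(\sum_(i < N.+1) r), z *m (1%:M - G) = 0 ->
         forall j : 'I_N.+1, (0 < j)%N -> submxrow z j = 0),
      (* the equations of levels j >= 1 leave z_0 free *)
      (forall z : 'rV[K]_(\sum_(i < N.+1) r),
         (forall j : 'I_N.+1, (0 < j)%N -> submxrow z j = 0) ->
         forall j : 'I_N.+1, (0 < j)%N -> submxrow (z *m (1%:M - G)) j = 0),
      (forall j : 'I_N.+1, (0 < j)%N ->
         1%:M - Phi_block Pr X j \in unitmx) &
      (forall p y z : 'rV[K]_(\sum_(i < N.+1) r),
         y = p *m (1%:M - R) -> z = y *m (1%:M - Phi) ->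
         (forall j : 'I_N.+1,
            submxrow z j = submxrow y j *m (1%:M - Phi_block Pr X j)) /\
         (p *m (1%:M - P) = 0 ->
          [/\ (forall j : 'I_N.+1, (0 < j)%N -> submxrow y j = 0),
              (submxrow z ord0 <= kermx (1%:M - Phi_block Pr X ord0))%MS &
              (submxrow y ord0 <= kermx (1%:M - Phi_block Pr X ord0))%MS]))] /\
  (* the stationary row vector of Phi_0 *)
  (exists! phi : 'rV[K]_r, stationary (Phi_block Pr X ord0) phi) /\
  (forall phi : 'rV[K]_r, stationary (Phi_block Pr X ord0) phi ->
     forall p y : 'rV[K]_(\sum_(i < N.+1) r),
     y = p *m (1%:M - R) -> p *m (1%:M - P) = 0 -> p <> 0 ->
     exists c : K, c <> 0 /\
       y = \mxrow_(j < N.+1) (if j == ord0 then c *: phi else 0)) /\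
  (* (2) back substitution *)
  [/\ unit_upper_block (1%:M - R),
      (forall p y : 'rV[K]_(\sum_(i < N.+1) r), y = p *m (1%:M - R) ->
         submxrow y ord0 = submxrow p ord0 /\
         (forall j : 'I_N.+1, (0 < j)%N ->
            submxrow y j = submxrow p j
              - \sum_(i < N.+1 | (i < j)%N) submxrow p i *m R_block Pr X i j)),
      (forall p : 'rV[K]_(\sum_(i < N.+1) r), p *m (1%:M - P) = 0 ->
         forall j : 'I_N.+1, (0 < j)%N ->
           submxrow p j
           = \sum_(i < N.+1 | (i < j)%N) submxrow p i *m R_block Pr X i j),
      (forall phi : 'rV[K]_r, stationary (Phi_block Pr X ord0) phi ->
         forall p : 'rV[K]_(\sum_(i < N.+1) r),
         p *m (1%:M - P) = 0 -> (forall a, 0 <= p 0 a) -> p <> 0 ->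
         exists c : K, 0 < c /\ submxrow p ord0 = c *: phi) &
      (* the procedure returns the stationary vector of P *)
      (forall phi : 'rV[K]_r, stationary (Phi_block Pr X ord0) phi ->
         forall (c : K) (p : 'rV[K]_(\sum_(i < N.+1) r)),
         0 < c -> submxrow p ord0 = c *: phi ->
         (forall j : 'I_N.+1, (0 < j)%N ->
            submxrow p j
            = \sum_(i < N.+1 | (i < j)%N) submxrow p i *m R_block Pr X i j) ->
         0 < \sum_a p 0 a /\
         unique (stationary P) ((\sum_a p 0 a)^-1 *: p))].
Proof.
have upR := one_sub_R_unit_upper Pr X; rewrite -hR in upR.
have loG := one_sub_G_unit_lower Pr X; rewrite -hG in loG.
have uG := unit_lower_block_unitmx loG.
pose Ph := Phi_block Pr X.
have Ph_ge0 : forall a b, 0 <= Ph ord0 a b by exact: Phi_block_ge0.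
have PhiE : Phi = \mxdiag_k Ph k by [].
rewrite PhiE in hRG *.
have RbE (i j : 'I_N.+1) : (i < j)%N -> submxblock R i j = R_block Pr X i j.
  by move=> ij; rewrite hR /R_mx mxblockK ij.
have R_ge0 (i j : 'I_N.+1) a b : 0 <= submxblock R i j a b.
  rewrite hR /R_mx mxblockK; case: ifP => _; first exact: R_block_ge0.
  by rewrite mxE.
have sumRE (p : 'rV[K]_(\sum_(i < N.+1) r)) (j : 'I_N.+1) :
    \sum_(i < N.+1 | (i < j)%N) submxrow p i *m R_block Pr X i j =
    \sum_(i < N.+1 | (i < j)%N) submxrow p i *m submxblock R i j.
  by apply: eq_bigr => i ij; rewrite RbE.
have uPh := Phi_unit hr hstoch hirr upR loG Ph_ge0 hRG.
have nullB := left_null_blocks hr hstoch hirr upR loG Ph_ge0 hRG.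
have null0 := left_null_level0 hr hstoch hirr upR loG Ph_ge0 hRG.
(* The unit triangular equation has only the zero solution; level 0 included. *)
have z_eq0 (z : 'rV[K]_(\sum_(i < N.+1) r)) : z *m (1%:M - G) = 0 -> z = 0.
  by move=> zG; rewrite -[z](mulmxK uG) zG mul0mx.
split; [|split; [split|split; [|split; [|split]]]].
- by move=> p y z -> ->; rewrite hRG !mulmxA.
- exact: loG.
- by move=> z /z_eq0 -> j _; rewrite submxrow0.
- move=> z z0 j j_gt0; rewrite submxrow_mul big1// => i _.
  (* Only level 0 of z survives, and 1 - G has no block from level 0 to j. *)
  have [i0|i_gt0] := posnP i; last by rewrite z0 ?mul0mx.
  by rewrite loG.2 ?i0 ?mulmx0.
- exact: uPh.
- move=> p y z -> ->; split=> [j|pP]; first exact: submxrow_mul_one_sub_mxdiag.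
  have [y0K yj0] := nullB _ pP; split=> //; last exact/sub_kermxP.
  by rewrite submxrow_mul_one_sub_mxdiag y0K sub0mx.
- exact: stationary_Phi0_unique hr hstoch hirr upR loG Ph_ge0 hRG.
- by move=> phi statphi p y -> pP p0; exact: null0.
- exact: upR.
- move=> p y ->; split=> [|j j_gt0]; first exact: submxrow_one_sub_R0.
  by rewrite sumRE submxrow_mul_one_sub_R.
- move=> p /nullB[_ y0] j j_gt0; apply/eqP; rewrite sumRE -subr_eq0.
  by rewrite -submxrow_mul_one_sub_R// y0.
- move=> phi statphi p pP p_ge0 /(null0 _ _ statphi pP)[c [c_neq0 yE]].
  have p0E : submxrow p ord0 = c *: phi.
    by rewrite -(submxrow_one_sub_R0 upR) yE mxrowK eqxx.
  (* c is the sum of the entries of c *: phi, the block p_0 >= 0. *)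
  exists c; split=> //; rewrite lt0r; apply/andP; split; first exact/eqP.
  case: statphi => _ _ phi1; rewrite -[c]mulr1 -phi1 mulr_sumr sumr_ge0// => a _.
  by have /rowP/(_ a) := p0E; rewrite !mxE => <-.
- move=> phi statphi c p c_gt0 p0 prec.
  have prec' (j : 'I_N.+1) : (0 < j)%N -> submxrow p j =
      \sum_(i < N.+1 | (i < j)%N) submxrow p i *m submxblock R i j.
    by move=> j_gt0; rewrite prec// sumRE.
  apply: normalized_null_stationary => //.
  + exact: back_substitution_null upR loG hRG _ _ _ statphi p0 prec'.
  + case: statphi => _ phi_ge0 _.
    exact: back_substitution_ge0 R_ge0 phi_ge0 (ltW c_gt0) p0 prec'.
  + have [_ phi0] := stationary_kermx statphi.
    apply/eqP => pz; move/eqP: p0; rewrite pz submxrow0 eq_sym scaler_eq0.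
    by rewrite gt_eqF// (negPf phi0).
Qed.
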